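(* Let $0<a<1$ and let $f:[0,a]\to[0,1]$ be a continuous injection such that $f(0)=0$, $f(a)=1$, and $f(x)>x$ for each $0<x\le a$. Let $0<b<1$ and let $g:[0,1]\to[0,1]$ be a continuous injection such that $g(0)=0$, $g(1)=b$, and $g(x)<x$ for each $0<x\le 1$. Let $f\cup g\subset[0,1]^2$ be the closed relation which is the union of the graphs of $f$ and $g$. Then $f\cup g$ is CR-turbulent and reverse CR-turbulent.
   Context: $\mathbb{N}$ denotes the positive integers. For a closed relation $F\subset X\times X$ on a compact metric space $X$ and $n\in\mathbb{N}$, $X_F^n=\{(x_1,\dots,x_{n+1})\in X^{n+1}: (x_i,x_{i+1})\in F \text{ for } 1\le i\le n\}$, and $\pi_i$ is the projection to the $i$-th coordinate. $F$ is CR-turbulent if there are $n\in\mathbb{N}$ and two disjoint nonempty closed sets $K,L\subset X_F^n$ such that $\pi_1(K)\cup\pi_1(L)\subset\pi_{n+1}(K)\cap\pi_{n+1}(L)$ (here $\pi_{n+1}$ is the last coordinate). $F$ is reverse CR-turbulent if there are $n\in\mathbb{N}$ and two disjoint nonempty closed sets $K,L\subset X_F^n$ such that $\pi_{n+1}(K)\cup\pi_{n+1}(L)\subset\pi_1(K)\cap\pi_1(L)$. *)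

(* Defs.v *)
From HB Require Import structures.
From mathcomp Require Import all_boot all_order all_algebra.
From mathcomp Require Import all_classical all_reals all_analysis.

Set Implicit Arguments.
Unset Strict Implicit.
Unset Printing Implicit Defensive.

Import Order.TTheory GRing.Theory Num.Theory.
Import numFieldNormedType.Exports.

Local Open Scope classical_set_scope.
Local Open Scope ring_scope.

(* These notions are meant for closed relations on compact metric spaces, but
   defining them only uses the topology of X. *)
Section ClosedRelations.
Context {X : topologicalType}.

(* The coordinates x_1, ..., x_{n+1} are indexed from 0: x_{i+1} is [x i] for
   i : 'I_n.+1.  [prod_topology] is X^{n+1} with the product topology. *)
Definition Mahavier (F : set (X * X)) (n : nat) :
    set (prod_topology (fun _ : 'I_n.+1 => X)) :=
  [set x | forall i : 'I_n, F (x (widen_ord (leqnSn n) i), x (lift ord0 i))].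
Arguments Mahavier F n : clear implicits.

Definition pi_ (F : set (X * X)) (n : nat) (i : 'I_n.+1)
  (x : Mahavier F n) : X := set_val x i.

(* [K] and [L] are subsets of the subtype of X^{n+1} carved out by
   [Mahavier F n], so [closed] refers to its subspace topology. *)
Definition CR_turbulent (F : set (X * X)) : Prop :=
  exists n : nat, (0 < n)%N /\
  exists K L : set (Mahavier F n),
    [/\ closed K /\ closed L, K !=set0 /\ L !=set0, K `&` L = set0 &
        pi_ ord0 @` K `|` pi_ ord0 @` L `<=`
        pi_ ord_max @` K `&` pi_ ord_max @` L].

Definition reverse_CR_turbulent (F : set (X * X)) : Prop :=
  exists n : nat, (0 < n)%N /\
  exists K L : set (Mahavier F n),
    [/\ closed K /\ closed L, K !=set0 /\ L !=set0, K `&` L = set0 &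
        pi_ ord_max @` K `|` pi_ ord_max @` L `<=`
        pi_ ord0 @` K `&` pi_ ord0 @` L].

End ClosedRelations.

Arguments Mahavier {X} F n.

(* The unit interval as a space in its own right (a subtype of R with the
   subspace topology). *)
Definition unit_interval (R : realType) : topologicalType :=
  set_type (`[0, 1]%classic : set R).

(* The graph of the restriction of [h] to [A], as a relation on [0, 1]; it is
   the whole graph when [A] is included in [0, 1] and [h] maps [A] to [0, 1]. *)
Definition graph_on (R : realType) (A : set R) (h : R -> R) :
    set (unit_interval R * unit_interval R) :=
  [set p | A (set_val p.1) /\ set_val p.2 = h (set_val p.1)].

(* Main.v *)
Require Import Defs.
From HB Require Import structures.
From mathcomp Require Import all_boot all_order all_algebra.
From mathcomp Require Import all_classical all_reals all_analysis.
From mathcomp Require Import lra.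

Import Order.TTheory GRing.Theory Num.Theory.
Import numFieldNormedType.Exports.

Local Open Scope classical_set_scope.
Local Open Scope ring_scope.

(** The relation moves points up by [f] and down by [g], and the point is that
    these two moves can be used to steer every orbit back into one fixed
    interval within a fixed number of steps, whatever the first move was.

    Let [p] be the point with [f p = a] and put [c = g p].  The map equal to
    [f] on [[0, p]] and to [g] on [(p, 1]] sends [[c, a]] into itself: below
    [p] it pushes up but not beyond [f p = a], above [p] it pushes down but not
    beyond [g p = c].  Outside [[c, a]] it moves towards [[c, a]], by steps that
    compactness bounds below on [[g c, c]] and on [[a, 1]], and it does not jump
    over [[c, a]].  So some fixed iterate [N] maps the whole of [[g c, 1]] into
    [[c, a]] (lemmas [iter_absorbed] and [absorbing_strategy]).  Both [f] and
    [g] map [[c, a]] into [[g c, 1]].  Hence each point of [[c, a]] starts an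
    orbit of length [N + 1] which ends in [[c, a]] and whose first move is [f],
    and another one whose first move is [g].

    Let [K] and [L] consist of the orbits of length [N + 1] with both ends in
    [[c, a]] which begin by a move up, respectively down.  They are closed, they
    are disjoint because neither branch fixes a positive point, and both of them
    project onto [[c, a]] by the first coordinate: this is reverse turbulence
    ([branches_reverse_CR_turbulent]).

    The hypotheses are symmetric under passing to the converse relation: the
    inverse of [g] is an expanding branch on [[0, b]] and the inverse of [f] is a
    contracting one with value [a] at [1] ([con_inverse], [exp_inverse]).  Since
    reading orbits backwards turns reverse turbulence of a relation into
    turbulence of its converse ([reverse_CR_turbulent_converse]), the first half
    of the conclusion follows from the second. *)

(** * Finite orbits and their reversal *)

Lemma continuous_to_prod {I : Type} {T X : topologicalType}
    (u : T -> prod_topology (fun _ : I => X)) :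
  (forall i, continuous (fun t => u t i)) -> continuous u.
Proof.
move=> uC t; apply/cvg_sup => i.
by apply: (continuous_comp_initial (w := fun h : I -> X => h i)); exact: uC.
Qed.

Lemma pi_continuous {X : topologicalType} (F : set (X * X)) n (i : 'I_n.+1) :
  continuous (@pi_ X F n i).
Proof.
move=> x; apply: (@continuous_comp _ _ _ (@set_val _ (Mahavier F n))
  (fun y : prod_topology (fun _ : 'I_n.+1 => X) => y i)).
  exact: initial_continuous.
exact: (@proj_continuous _ (fun _ : 'I_n.+1 => X)).
Qed.

Section Reversal.
Context {X : topologicalType} {F G : set (X * X)}
  (FG : forall x y, F (x, y) -> G (y, x)).

Lemma Mahavier_rev {n} (x : prod_topology (fun _ : 'I_n.+1 => X)) :
  Mahavier F n x -> Mahavier G n (fun i => x (rev_ord i)).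
Proof.
move=> Fx i /=; apply: FG; have := Fx (rev_ord i).
congr (F (x _, x _)); apply: val_inj => /=.
  by rewrite /bump /= add1n subSS.
by rewrite /bump /= add1n !subSS subnSK.
Qed.

Definition rev_path {n} (x : Mahavier F n) : Mahavier G n :=
  SigSub (mem_set (Mahavier_rev _ (set_valP x))).

Lemma pi_rev n i (x : Mahavier F n) : pi_ i (rev_path x) = pi_ (rev_ord i) x.
Proof. by []. Qed.

Lemma rev_path_continuous n : continuous (@rev_path n).
Proof.
apply: continuous_comp_initial; apply: continuous_to_prod => i.
exact: (@pi_continuous _ F n (rev_ord i)).
Qed.
End Reversal.

(** Path reversal is a homeomorphism between the two path spaces which exchanges
    the first and the last coordinate, so the witnesses for [G] are the preimages
    of those for [F]. *)
Lemma reverse_CR_turbulent_converse {X : topologicalType} (F G : set (X * X)) :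
  (forall x y, F (x, y) <-> G (y, x)) ->
  reverse_CR_turbulent F -> CR_turbulent G.
Proof.
move=> FG [n [n0 [K [L [[Kc Lc] [K0 L0] KL sub]]]]].
have FG1 x y : F (x, y) -> G (y, x) by move/FG.
have GF1 x y : G (x, y) -> F (y, x) by move/FG.
pose r := @rev_path _ _ _ GF1 n.
pose s := @rev_path _ _ _ FG1 n.
have sK : cancel s r.
  by move=> x; apply: val_inj; apply/funext => i /=; rewrite rev_ordK.
have im i (M : set (Mahavier F n)) : pi_ i @` (r @^-1` M) = pi_ (rev_ord i) @` M.
  apply/seteqP; split=> [_ [x Mx <-]|_ [x Mx <-]].
    by exists (r x) => //; rewrite pi_rev rev_ordK.
  by exists (s x); rewrite ?pi_rev//= sK.
have r0 : rev_ord (@ord0 n) = ord_max by apply: val_inj; rewrite /= subn1.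
have rm : rev_ord (@ord_max n) = ord0 by apply: val_inj; rewrite /= subnn.
exists n; split=> //; exists (r @^-1` K), (r @^-1` L); split.
- by split; apply: preimage_closed => // x _; exact: rev_path_continuous.
- split; [case: K0 => x Kx|case: L0 => x Kx];
    by exists (s x); rewrite /preimage/= sK.
- by rewrite -preimage_setI KL preimage_set0.
- by rewrite !im r0 rm.
Qed.

(** The steering argument takes place in the ambient field; this turns the
    resulting numerical orbits into points of the path space. *)
Lemma orbit_path {R : realType} (F : set (unit_interval R * unit_interval R))
    (S : R -> R -> Prop) (n : nat) (s : nat -> R) :
  (forall x y : unit_interval R, S (set_val x) (set_val y) -> F (x, y)) ->
  (forall k, 0 <= s k <= 1) -> (forall k, S (s k) (s k.+1)) ->
  exists x : Mahavier F n, forall i : 'I_n.+1, set_val (pi_ i x) = s i.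
Proof.
move=> SF s01 sS.
have sI k : (`[0, 1]%classic : set R) (s k) by rewrite /= in_itv /= s01.
pose u k : unit_interval R := SigSub (mem_set (sI k)).
have uF : Mahavier F n (fun i => u i).
  by move=> i /=; apply: SF; rewrite !set_valE /= /bump /= add1n.
by exists (SigSub (mem_set uF)) => i; rewrite /pi_ !set_valE.
Qed.


(** * A two-branch strategy with an absorbing interval *)

(** An orbit outside [[c, d]] stays on its side, moving by at least [t] at each
    step, until it lands in [[c, d]], where it remains; it can spend at most
    [(D - e) / t] steps outside.  The bounds by [d] in the first hypothesis and
    by [c] in the third prevent it from jumping over the interval. *)
Lemma iter_absorbed {R : realType} (h : R -> R) (e c d D t : R) :
  0 < t -> e <= d -> c <= D ->
  (forall z, e <= z < c -> z + t <= h z <= d) ->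
  (forall z, c <= z <= d -> c <= h z <= d) ->
  (forall z, d < z <= D -> c <= h z <= z - t) ->
  exists N, forall z, e <= z <= D -> c <= iter N h z <= d.
Proof.
move=> t0 ed cD lo mid hi.
have inv k z : e <= z <= D ->
    [|| c <= iter k h z <= d, e + k%:R * t <= iter k h z < c |
        d < iter k h z <= D - k%:R * t].
  move=> /andP[ez zD]; elim: k => [|k] /=.
    by rewrite mul0r addr0 subr0 ez zD /=; case: (ltP z c); case: (ltP d z);
      rewrite ?orbT.
  have kt : 0 <= k%:R * t by rewrite mulr_ge0// ltW.
  have -> : k.+1%:R = k%:R + 1 :> R by rewrite natr1.
  set w := iter k h z.
  case/or3P => [/mid ->//|/andP[w1 w2]|/andP[w1 w2]].
    have /lo/andP[h1 h2] : e <= w < c by apply/andP; split=> //; lra.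
    by case: (ltP (h w) c) => hc; rewrite ?h2 ?hc ?orbT//= andbT;
      apply/orP; left; lra.
  have /hi/andP[h1 h2] : d < w <= D by apply/andP; split=> //; lra.
  by case: (ltP d (h w)) => hd; rewrite ?h1 ?hd ?orbT//=; apply/orP; right; lra.
(* A number of steps whose total displacement exceeds the length of [e, D]
   leaves only the first case of the invariant. *)
exists (Num.bound ((D - e) / t)) => z zeD.
have DN : D - e < (Num.bound ((D - e) / t))%:R * t.
  rewrite -ltr_pdivrMr//; apply: archi_boundP; apply: divr_ge0; last exact: ltW.
  by move: zeD => /andP[]; lra.
by case/or3P: (inv (Num.bound ((D - e) / t)) z zeD) => // /andP[h1 h2]; exfalso; lra.
Qed.

Lemma positive_lower_bound {R : realType} (u v : R) (h : R -> R) :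
  {within `[u, v], continuous h} -> (forall z, u <= z <= v -> 0 < h z) ->
  exists2 t, 0 < t & forall z, u <= z <= v -> t <= h z.
Proof.
move=> hC h0; have [uv|vu] := leP u v.
  have [m] := EVT_min uv hC; rewrite in_itv /= => /h0 m0 mP.
  by exists (h m) => // z zuv; apply: mP; rewrite in_itv.
by exists 1 => // z /andP[uz /(le_trans uz)]; rewrite leNgt vu.
Qed.

Record expanding_branch {R : realType} (a : R) (f : R -> R) : Prop := {
  exp_itv : 0 < a < 1;
  exp_cont : {within `[0, a], continuous f};
  exp_inj : {in `[0, a] &, injective f};
  exp0 : f 0 = 0;
  exp1 : f a = 1;
  exp_gt : forall x, 0 < x <= a -> x < f x }.

Record contracting_branch {R : realType} (b : R) (g : R -> R) : Prop := {
  con_itv : 0 < b < 1;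
  con_cont : {within `[0, 1], continuous g};
  con_inj : {in `[0, 1] &, injective g};
  con0 : g 0 = 0;
  con1 : g 1 = b;
  con_lt : forall x, 0 < x <= 1 -> g x < x }.

Lemma exp_mono {R : realType} {a : R} {f} : expanding_branch a f ->
  forall x y, 0 <= x <= a -> 0 <= y <= a -> (f x <= f y) = (x <= y).
Proof.
move=> [/andP[a0 a1] fC fI f0 fa _] x y xI yI.
have fle : f 0 <= f a by rewrite f0 fa ler01.
by apply: (segment_continuous_inj_le fle fC fI); rewrite in_itv.
Qed.

Lemma con_mono {R : realType} {b : R} {g} : contracting_branch b g ->
  forall x y, 0 <= x <= 1 -> 0 <= y <= 1 -> (g x <= g y) = (x <= y).
Proof.
move=> [/andP[b0 b1] gC gI g0 gb _] x y xI yI.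
have gle : g 0 <= g 1 by rewrite g0 gb ltW.
by apply: (segment_continuous_inj_le gle gC gI); rewrite in_itv.
Qed.

(** Here [c] is the image by [g] of the point that [f] sends to [a].  The number
    of steps is the same for all starting points, which is what makes it possible
    to work in a single path space. *)
Lemma absorbing_strategy {R : realType} {a b : R} {f g : R -> R} :
  expanding_branch a f -> contracting_branch b g ->
  exists c (h : R -> R) N,
  [/\ 0 < c <= a,
      forall z, (z <= a /\ h z = f z) \/ h z = g z,
      forall z, c <= z <= a -> c <= iter N h (f z) <= a &
      forall z, c <= z <= a -> c <= iter N h (g z) <= a].
Proof.
move=> fE gE.
have [/andP[a0 a1] fC _ f0 fa f_gt] := fE.
have [/andP[b0 b1] gC _ g0 g1 g_lt] := gE.
have g_gt0 z : 0 < z <= 1 -> 0 < g z.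
  move=> /andP[z0 z1]; rewrite -g0 ltNge (con_mono gE) ?lexx ?ler01 -?ltNge//.
  by rewrite (ltW z0).
have [p pa fp] : exists2 p, p \in `[0, a] & f p = a.
  apply: IVT => //; first exact: ltW.
  by rewrite f0 fa (min_idPl ler01) (max_idPr ler01) !ltW.
move: pa; rewrite in_itv /= => /andP[p0 pa].
have {}p0 : 0 < p.
  by rewrite lt_neqAle p0 andbT; apply/eqP => p0'; move: fp a0;
     rewrite -p0' f0 => <-; rewrite ltxx.
have {}pa : p < a by rewrite -[ltRHS]fp f_gt// p0.
have [c gp] : exists c, g p = c by exists (g p).
have [e gc] : exists e, g c = e by exists (g c).
have c0 : 0 < c by rewrite -gp; apply: g_gt0; lra.
have cp : c < p by rewrite -gp; apply: g_lt; lra.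
have e0 : 0 < e by rewrite -gc; apply: g_gt0; lra.
have ec : e < c by rewrite -gc; apply: g_lt; lra.
(* Strict displacement is uniform only away from the fixed point 0, whence the
   lower end e. *)
have [t1 t10 t1P] : exists2 t, 0 < t & forall z, e <= z <= p -> t <= f z - z.
  apply: positive_lower_bound.
    apply: within_continuousB; last by apply: continuous_subspaceT => x; exact: cvg_id.
    apply: continuous_subspaceW fC => z /=; rewrite !in_itv /=.
    by move=> /andP[? ?]; apply/andP; lra.
  by move=> z /andP[? ?]; rewrite subr_gt0 f_gt//; apply/andP; lra.
have [t2 t20 t2P] : exists2 t, 0 < t & forall z, a <= z <= 1 -> t <= z - g z.
  apply: positive_lower_bound.
    apply: within_continuousB; first by apply: continuous_subspaceT => x; exact: cvg_id.
    apply: continuous_subspaceW gC => z /=; rewrite !in_itv /=.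
    by move=> /andP[? ?]; apply/andP; lra.
  by move=> z /andP[? ?]; rewrite subr_gt0 g_lt//; apply/andP; lra.
pose h z := if z <= p then f z else g z.
have f_le z : 0 <= z -> z <= p -> f z <= a.
  by move=> z0 zp; rewrite -fp (exp_mono fE)//; apply/andP; lra.
have g_ge z : p < z -> z <= 1 -> c <= g z.
  by move=> pz z1; rewrite -gp (con_mono gE); [exact: ltW|..]; apply/andP; lra.
have [||||||N NP] := @iter_absorbed R h e c a 1 (Num.min t1 t2).
- by rewrite lt_min t10.
- lra.
- lra.
- move=> z /andP[ez zc]; have zp : z <= p by lra.
  rewrite /h zp f_le ?andbT//; last lra.
  have : t1 <= f z - z by apply: t1P; rewrite ez.
  have : Num.min t1 t2 <= t1 by rewrite ge_min lexx.
  lra.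
- move=> z /andP[cz za]; rewrite /h; case: (leP z p) => zp.
    rewrite f_le// ?andbT; last lra.
    by rewrite (le_trans cz)// ltW// f_gt//; lra.
  by rewrite g_ge//=; [apply: ltW; apply: lt_le_trans (g_lt _ _) _|]; lra.
- move=> z /andP[az z1]; have pz : p < z by lra.
  rewrite /h (lt_geF pz) g_ge//=.
  have : t2 <= z - g z by apply: t2P; rewrite (ltW az).
  have : Num.min t1 t2 <= t2 by rewrite ge_min lexx orbT.
  lra.
exists c, h, N; split.
- by apply/andP; lra.
- by move=> z; rewrite /h; case: (leP z p) => zp; [left; split=> //; lra|right].
- move=> z /andP[cz za]; apply: NP; have z0 : 0 < z by lra.
  apply/andP; split; last first.
    by rewrite -fa (exp_mono fE)//; apply/andP; lra.
  by rewrite ltW// (lt_trans ec)// (le_lt_trans cz)// f_gt// z0.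
- move=> z /andP[cz za]; apply: NP; have z0 : 0 < z by lra.
  apply/andP; split; last by rewrite ltW// (lt_le_trans (g_lt _ _))//; lra.
  by rewrite -gc (con_mono gE)//; apply/andP; lra.
Qed.

(** * Turbulence *)

Lemma closed_le_fun {R : realType} {T : topologicalType} (u v : T -> R) :
  continuous u -> continuous v -> closed [set x | u x <= v x].
Proof.
move=> uC vC.
have -> : [set x | u x <= v x] = (v - u) @^-1` [set r | 0 <= r].
  by apply/seteqP; split=> x; rewrite /= !fctE subr_ge0.
apply: preimage_closed; last exact: closed_ge.
by move=> x _; apply: cvgB; [exact: vC|exact: uC].
Qed.

(** The first move of an orbit is detected by comparing its first two
    coordinates, as [f] moves positive points strictly up and [g] strictly down;
    so the two witnesses are cut out by large inequalities, hence closed, and are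
    nevertheless disjoint. *)
Lemma branches_reverse_CR_turbulent {R : realType} {a b : R} {f g : R -> R} :
  expanding_branch a f -> contracting_branch b g ->
  reverse_CR_turbulent (graph_on `[0, a] f `|` graph_on `[0, 1] g).
Proof.
move=> fE gE; set F := _ `|` _.
have [c [h [N [/andP[c0 ca] hfg absf absg]]]] := absorbing_strategy fE gE.
have [/andP[a0 a1] _ _ f0 fa f_gt] := fE.
have [/andP[b0 b1] _ _ g0 g1 g_lt] := gE.
pose S (x y : R) := (0 <= x <= a /\ y = f x) \/ (0 <= x <= 1 /\ y = g x).
have FS (x y : unit_interval R) : F (x, y) <-> S (set_val x) (set_val y).
  by rewrite /F /S /graph_on /= !in_itv /=.
have f01 x : 0 <= x <= a -> 0 <= f x <= 1.
  move=> xa; rewrite -[X in X <= f x]f0 -[X in f x <= X]fa.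
  by rewrite !(exp_mono fE)// !lexx ltW.
have g01 x : 0 <= x <= 1 -> 0 <= g x <= 1.
  move=> /[dup] xI /andP[x0 x1]; apply/andP; split.
    by rewrite -g0 (con_mono gE) ?lexx ?ler01.
  apply: (@le_trans _ _ b); last exact: ltW.
  by rewrite -g1 (con_mono gE) ?lexx ?ler01.
have S01 x y : S x y -> 0 <= y <= 1 by case=> -[xI ->]; [exact: f01|exact: g01].
have Sh z : 0 <= z <= 1 -> S z (h z).
  move=> zI; case: (hfg z) => [[za ->]|->]; last by right.
  by left; split=> //; case/andP: zI => ->.
pose n := N.+1.
pose one : 'I_n.+1 := lift ord0 ord0.
pose X (i : 'I_n.+1) (x : Mahavier F n) : R := set_val (pi_ i x).
have XC i : continuous (X i).
  move=> x; apply: (@continuous_comp _ _ _ (@pi_ _ F n i)).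
    exact: pi_continuous.
  exact: initial_continuous.
have cstC (r : R) : continuous (fun _ : Mahavier F n => r).
  by move=> x; exact: (@cst_continuous (Mahavier F n) R).
pose A := [set x : Mahavier F n | c <= X ord0 x] `&` [set x | X ord0 x <= a] `&`
  ([set x | c <= X ord_max x] `&` [set x | X ord_max x <= a]).
have Ac : closed A.
  by do 3 ?apply: closedI; apply: closed_le_fun.
pose K := A `&` [set x | X ord0 x <= X one x].
pose L := A `&` [set x | X one x <= X ord0 x].
have path y z : c <= y <= a -> S y z -> c <= iter N h z <= a ->
    exists x, [/\ A x, X ord0 x = y & X one x = z].
  move=> yA Syz zA; have [/andP[cy ya] /andP[cz za]] := (yA, zA).
  pose s k := if k is k'.+1 then iter k' h z else y.
  have s01 k : 0 <= s k <= 1.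
    case: k => [|k] /=; first by apply/andP; lra.
    elim: k => [|k IH] /=; [exact: S01 Syz|exact: S01 (Sh _ IH)].
  have sS k : S (s k) (s k.+1) by case: k => [//|k]; exact: (Sh _ (s01 k.+1)).
  have [x xs] := @orbit_path R F S n s (fun x y => (FS x y).2) s01 sS.
  by exists x; rewrite /A /X /= !xs.
have toK y : c <= y <= a -> exists2 x, K x & X ord0 x = y.
  move=> yA; have y0 : 0 < y <= a by case/andP: yA => ? ?; apply/andP; lra.
  have [||x [Ax xy xz]] := path y (f y) yA; last exists x => //.
  - by left; split=> //; case/andP: y0 => ? ?; apply/andP; lra.
  - exact: absf.
  - by split=> //=; rewrite xy xz ltW// f_gt.
have toL y : c <= y <= a -> exists2 x, L x & X ord0 x = y.
  move=> yA; have y0 : 0 < y <= 1 by case/andP: yA => ? ?; apply/andP; lra.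
  have [||x [Ax xy xz]] := path y (g y) yA; last exists x => //.
  - by right; split=> //; case/andP: y0 => ? ?; apply/andP; lra.
  - exact: absg.
  - by split=> //=; rewrite xy xz ltW// g_lt.
have val_inj' (u v : unit_interval R) : set_val u = set_val v -> u = v.
  by rewrite !set_valE => /val_inj.
exists n; split=> //; exists K, L; split.
- by split; apply: closedI => //; apply: closed_le_fun.
- have cA : c <= c <= a by rewrite lexx.
  by split; [have [x] := toK c cA|have [x] := toL c cA]; exists x.
- apply/seteqP; split=> // x [[Ax /= x01] [_ /= x10]].
  have e : X one x = X ord0 x by apply/eqP; rewrite eq_le x10.
  case: Ax => -[/= cx xa] _.
  have /FS := set_valP x ord0.
  have -> : widen_ord (leqnSn n) ord0 = ord0 by apply: val_inj.
  have -> : set_val (set_val x (lift ord0 ord0)) = X ord0 x by rewrite -e.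
  rewrite -[set_val (set_val x ord0)]/(X ord0 x) => -[[_ Ef]|[_ Eg]].
    have /f_gt : 0 < X ord0 x <= a by apply/andP; lra.
    by rewrite -Ef ltxx.
  have /g_lt : 0 < X ord0 x <= 1 by apply/andP; lra.
  by rewrite -Eg ltxx.
- have sub M : M `<=` A -> pi_ ord_max @` M `<=` pi_ ord0 @` K `&` pi_ ord0 @` L.
    move=> MA _ [x Mx <-]; have [_ [/= cx xa]] := MA x Mx.
    have xA : c <= X ord_max x <= a by rewrite cx.
    split; [have [w Kw wE] := toK _ xA|have [w Kw wE] := toL _ xA];
      by exists w => //; exact: val_inj'.
  by rewrite subUset; split; apply: sub => x [].
Qed.

(** * Exchanging the branches *)

(** The equivalence says that [k] and [h] have converse graphs, which is the form
    needed to pass to the converse of a union of graphs. *)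
Lemma increasing_inverse {R : realType} {u v : R} {h : R -> R} :
  u <= v -> h u <= h v ->
  {within `[u, v], continuous h} -> {in `[u, v] &, injective h} ->
  exists k, [/\ {within `[h u, h v], continuous k},
    {in `[h u, h v] &, injective k} &
    forall x y, (h u <= y <= h v /\ x = k y) <-> (u <= x <= v /\ y = h x)].
Proof.
move=> uv huv hC hI.
have hM := segment_continuous_inj_le huv hC hI.
pose k := 'pinv_(fun=> u) `[u, v] h.
have hK : {in `[u, v], cancel h k}.
  move=> x xI; apply: (@pinvKV _ _ _ `[u, v]); last by rewrite inE.
  by move=> y z; rewrite !inE; exact: hI.
have kK := segment_continuous_le_can_sym uv hC hK.
exists k; split; [exact: segment_can_le_continuous|exact: can_in_inj kK|].
move=> x y; split=> -[I ->].
  have yI : y \in `[h u, h v] by rewrite in_itv.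
  have [z /= zI zy] := segment_continuous_le_surjective uv huv hC yI.
  by rewrite -zy hK //; move: zI; rewrite in_itv.
have xI : x \in `[u, v] by rewrite in_itv.
by case/andP: I => ux xv; rewrite hK// !hM ?ux ?in_itv /= ?lexx ?uv.
Qed.

Lemma exp_inverse {R : realType} {a : R} {f} : expanding_branch a f ->
  exists f', contracting_branch a f' /\
    forall x y, (0 <= y <= 1 /\ x = f' y) <-> (0 <= x <= a /\ y = f x).
Proof.
move=> [/[dup] aI /andP[a0 a1] fC fI f0 fa f_gt].
have fle : f 0 <= f a by rewrite f0 fa.
have [f' []] := increasing_inverse (ltW a0) fle fC fI.
rewrite f0 fa => f'C f'I inv; exists f'; split=> //; split=> //.
- by have [_ []] := (inv 0 0).2 (conj (introT andP (conj (lexx _) (ltW a0))) (esym f0)).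
- by have [_ []] := (inv a 1).2 (conj (introT andP (conj (ltW a0) (lexx _))) (esym fa)).
- move=> y /andP[y0 y1].
  have [|/andP[f'0 f'a] yE] := (inv (f' y) y).1; first by rewrite (ltW y0).
  rewrite [ltRHS]yE; apply: f_gt; rewrite f'a andbT lt_neqAle f'0 andbT.
  by apply/eqP => f'y; move: y0; rewrite yE -f'y f0 ltxx.
Qed.

Lemma con_inverse {R : realType} {b : R} {g} : contracting_branch b g ->
  exists g', expanding_branch b g' /\
    forall x y, (0 <= y <= b /\ x = g' y) <-> (0 <= x <= 1 /\ y = g x).
Proof.
move=> [/[dup] bI /andP[b0 b1] gC gI g0 g1 g_lt].
have gle : g 0 <= g 1 by rewrite g0 g1 ltW.
have [g' []] := increasing_inverse ler01 gle gC gI.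
rewrite g0 g1 => g'C g'I inv; exists g'; split=> //; split=> //.
- by have [_ []] := (inv 0 0).2 (conj (introT andP (conj (lexx _) ler01)) (esym g0)).
- by have [_ []] := (inv 1 b).2 (conj (introT andP (conj ler01 (lexx _))) (esym g1)).
- move=> y /andP[y0 y1].
  have [|/andP[g'0 g'1] yE] := (inv (g' y) y).1; first by rewrite (ltW y0).
  rewrite [ltLHS]yE; apply: g_lt; rewrite g'1 andbT lt_neqAle g'0 andbT.
  by apply/eqP => g'y; move: y0; rewrite yE -g'y g0 ltxx.
Qed.

Theorem theorem6p3 (R : realType) (a b : R) (f g : R -> R)
  (a01 : 0 < a < 1)
  (f_maps : set_fun `[0, a] `[0, 1] f)
  (f_cont : {within `[0, a], continuous f})
  (f_inj : set_inj `[0, a] f)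
  (f0 : f 0 = 0) (fa : f a = 1)
  (f_gt : forall x : R, 0 < x <= a -> x < f x)
  (b01 : 0 < b < 1)
  (g_maps : set_fun `[0, 1] `[0, 1] g)
  (g_cont : {within `[0, 1], continuous g})
  (g_inj : set_inj `[0, 1] g)
  (g0 : g 0 = 0) (g1 : g 1 = b)
  (g_lt : forall x : R, 0 < x <= 1 -> g x < x) :
  CR_turbulent (graph_on `[0, a] f `|` graph_on `[0, 1] g) /\
  reverse_CR_turbulent (graph_on `[0, a] f `|` graph_on `[0, 1] g).
Proof.
have fE : expanding_branch a f.
  by split=> // x y xI yI; apply: f_inj; rewrite inE.
have gE : contracting_branch b g.
  by split=> // x y xI yI; apply: g_inj; rewrite inE.
split; last exact: branches_reverse_CR_turbulent fE gE.
have [f' [f'E f'P]] := exp_inverse fE.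
have [g' [g'E g'P]] := con_inverse gE.
apply: (reverse_CR_turbulent_converse _ _ _
  (branches_reverse_CR_turbulent g'E f'E)).
move=> x y; rewrite /graph_on /= !in_itv /=.
by split=> -[]; [move/g'P; right|move/f'P; left|move/f'P; right|move/g'P; left].
Qed.
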